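(* For a regular Hausdorff space $X$ the following are equivalent: (1) $X$ is metrizable; (2) $\mathcal{K}(X)$ has a $\sigma$-locally finite weak base; (3) $\mathcal{K}(X)$ is metrizable.
   Context: $\mathcal{K}(X)$ is the set of nonempty compact subsets of $X$ with the Vietoris topology (base: $\langle U_1,\dots,U_k\rangle=\{K: K\subset\bigcup_i U_i,\ K\cap U_j\neq\emptyset\ \forall j\}$, $U_i$ open in $X$). A weak base for $Y$ is a cover $\mathcal{P}=\bigcup_{y\in Y}\mathcal{P}_y$ such that: for $U,V\in\mathcal{P}_y$ there is $W\in\mathcal{P}_y$ with $W\subset U\cap V$; each member of $\mathcal{P}_y$ contains $y$, and for each open $U\ni y$ some $P\in\mathcal{P}_y$ has $P\subset U$; and $G\subset Y$ is open whenever for each $y\in G$ some $P\in\mathcal{P}_y$ has $P\subset G$. $\sigma$-locally finite means a countable union of locally finite families. *)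

(* Defs.v *)
From HB Require Import structures.
From mathcomp Require Import all_boot all_order all_algebra.
From mathcomp Require Import all_classical all_reals topology Rstruct.
Set Implicit Arguments. Unset Strict Implicit. Unset Printing Implicit Defensive.
Import Order.TTheory GRing.Theory Num.Theory.
Local Open Scope classical_set_scope.
Local Open Scope ring_scope.

(* A topology on a type T is described by its family of open sets
   [op : set (set T)].  For a topologicalType X we use [@open X]. *)

Definition metrizable (T : Type) (op : set (set T)) : Prop :=
  exists d : T -> T -> Rdefinitions.R,
    [/\ (forall x y, 0 <= d x y),
        (forall x y, d x y = 0 <-> x = y),
        (forall x y, d x y = d y x),
        (forall x y z, d x z <= d x y + d y z) &
        (forall A : set T, op A <->
           (forall x, A x -> exists2 e : Rdefinitions.R, 0 < e &
                 forall y, d x y < e -> A y))].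

Definition locally_finite (T : Type) (op : set (set T)) (F : set (set T)) : Prop :=
  forall x : T, exists2 U : set T, op U /\ U x &
    finite_set [set A | F A /\ A `&` U !=set0].

Definition sigma_locally_finite (T : Type) (op : set (set T)) (F : set (set T)) :=
  exists G : nat -> set (set T),
    F = \bigcup_(n in setT) G n /\ forall n, locally_finite op (G n).

(* Weak base P = \bigcup_y P_y, with P y the family P_y. *)
Definition is_weak_base (T : Type) (op : set (set T)) (P : T -> set (set T)) :=
  [/\ (forall y U V, P y U -> P y V -> exists2 W, P y W & W `<=` U `&` V),
      (forall y U, P y U -> U y),
      (forall y U, op U -> U y -> exists2 Q, P y Q & Q `<=` U) &
      (forall G : set T, (forall y, G y -> exists2 Q, P y Q & Q `<=` G) -> op G)].

Definition has_sigma_lf_weak_base (T : Type) (op : set (set T)) : Prop :=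
  exists P : T -> set (set T), is_weak_base op P /\
    sigma_locally_finite op [set A | exists y, P y A].

Record hyperspace (X : topologicalType) := Hyp {
  hval : set X;
  hval_nonempty : hval !=set0;
  hval_compact : compact hval }.

Definition vietoris_basic (X : topologicalType) (Us : seq (set X))
  : set (hyperspace X) :=
  [set K | hval K `<=` \bigcup_(U in [set U | U \in Us]) U /\
           forall U, U \in Us -> hval K `&` U !=set0].

Definition vietoris_open (X : topologicalType) : set (set (hyperspace X)) :=
  [set G | forall K, G K -> exists Us : seq (set X),
     [/\ (forall U, U \in Us -> open U), vietoris_basic Us K &
         vietoris_basic Us `<=` G]].

(* Main.v *)
Require Import Defs.
From HB Require Import structures.
From mathcomp Require Import all_boot all_order all_algebra.
From mathcomp Require Import all_classical all_reals topology Rstruct.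
From mathcomp Require Import wochoice normedtype lra.
Set Implicit Arguments. Unset Strict Implicit. Unset Printing Implicit Defensive.
Import numFieldNormedType.Exports Order.TTheory GRing.Theory Num.Theory.
Local Open Scope classical_set_scope.
Local Open Scope ring_scope.

(* A metric of X yields the Hausdorff metric of K(X), and by Stone's theorem a metrizable
   space has a sigma-locally finite base. Conversely, a sigma-locally finite weak base of
   K(X) has countable trace at every point, and its trace on the singletons is a weak base
   of X. If a member of that trace at some x were not a neighbourhood of x, X would not be
   Frechet-Urysohn: there would be x_k -> y with each x_k a limit of a sequence in a set A
   in which no sequence tends to y. Adding points of A to the compact set consisting of y
   and all x_k gives infinitely many sequences converging to one point of K(X), and a
   diagonal sequence along a countable weak base there produces a sequence of A tending to
   y. Hence the interiors of the traces form a sigma-locally finite base of the regular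
   space X, which is metrizable by the Nagata-Smirnov theorem. *)

Local Notation R := Rdefinitions.R.

(** * Stone's theorem: sigma-locally finite bases of metrizable spaces *)

Definition metrizes (R : numDomainType) (T : Type) (op : set (set T)) (d : T -> T -> R) : Prop :=
  [/\ (forall x y, 0 <= d x y),
      (forall x y, d x y = 0 <-> x = y),
      (forall x y, d x y = d y x),
      (forall x y z, d x z <= d x y + d y z) &
      (forall A : set T, op A <->
         (forall x, A x -> exists2 e : R, 0 < e & forall y, d x y < e -> A y))].

Definition sigma_lf_base (T : Type) (op : set (set T)) (B : nat -> set (set T)) :=
  [/\ forall n, B n `<=` op,
      forall n, locally_finite op (B n) &
      forall x U, op U -> U x -> exists n V, [/\ B n V, V x & V `<=` U]].

Lemma well_ordering_prop (T : Type) : exists le : T -> T -> Prop,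
  (forall x y, le x y -> le y x -> x = y) /\
  (forall S : set T, S !=set0 -> exists2 z, S z & forall x, S x -> le z x).
Proof.
have [r wo] := well_ordering_principle {classic T}.
exists (fun x y => r x y); split=> [x y xy yx|S [s Ss]].
  have rr z : r z z.
    have [|w [[/eqP-> lb] _]] := wo [pred t | t == z]; first by exists z; apply: eqxx.
    by apply: lb; rewrite inE.
  (* By reflexivity both [x] and [y] would be least in the pair if they preceded each other, and
     least elements are unique. *)
  have [|w [[ww wm] wu]] := wo [pred t : {classic T} | (t == x) || (t == y)].
    by exists x; rewrite inE eqxx.
  have <- : w = x.
    by apply: wu; split; [rewrite inE eqxx|move=> t /orP[] /eqP ->].
  by apply: wu; split; [rewrite inE eqxx orbT|move=> t /orP[] /eqP ->].
have [|z [[/asboolP Sz zm] _]] := wo [pred t : {classic T} | `[< S t >]].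
  by exists s; exact/asboolP.
by exists z => // x Sx; apply: zm; exact/asboolP.
Qed.

Lemma exists_invS_lt (e : R) : 0 < e -> exists k, k.+1%:R^-1 < e.
Proof. by move=> /ltr_add_invr[k]; rewrite add0r; exists k. Qed.

Lemma metric_ball_open (T : Type) (op : set (set T)) (d : T -> T -> R) x e :
  metrizes op d -> op [set y | d x y < e].
Proof.
move=> [_ _ _ dt /(_ [set y | d x y < e])->] y /= xy; exists (e - d x y).
  by rewrite subr_gt0.
by move=> z yz; apply: le_lt_trans (dt x y z) _; rewrite -ltrBrDl.
Qed.

(* Stone's construction: thin each ball around p, in a well-ordered way, so that the
   pieces with a given pair of radii become uniformly discrete. *)
Lemma metrizable_sigma_lf_base (T : Type) (op : set (set T)) :
  metrizable op -> exists B, sigma_lf_base op B.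
Proof.
case=> d dm; have [d0 dE ds dt dop] := dm.
have [le [le_anti le_min]] := well_ordering_prop T.
pose r n : R := n.+1%:R^-1.
have r0 n : 0 < r n by rewrite invr_gt0.
(* The second clause lets only the least [p] whose [r n]-ball contains [x] claim it; the first keeps
   claims of different [p] at least [r k] apart, so that [E] can thicken them to open sets. *)
pose S n k p := [set x | (forall z, d x z < r k -> d p z < r n) /\
                         forall q, ~ le p q -> ~ d q x < r n].
pose E n k p := [set y | exists2 x, S n k p x & d x y < r k / 3].
(* Numbers that code no pair of radii get the empty family. *)
pose B i := if unpickle i is Some (n, k) then range (E n k) else set0.
have Dx n k p q : ~ le p q -> forall x x', S n k p x -> S n k q x' -> r k <= d x x'.
  move=> npq x x' [_ /(_ _ npq) xq] [qx' _]; rewrite leNgt; apply/negP => lt.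
  by apply/xq/qx'; rewrite ds.
have Du n k p q y y' : E n k p y -> E n k q y' -> d y y' < r k / 3 -> p = q.
  move=> [x Sx xy] [x' Sx' xy'] yy'.
  have : d x x' < r k.
    have := dt x y x'; have := dt y y' x'; rewrite (ds y' x'); lra.
  move=> lt; apply: le_anti; apply: contrapT => nle.
    by have := Dx _ _ _ _ nle _ _ Sx Sx'; rewrite leNgt lt.
  by have := Dx _ _ _ _ nle _ _ Sx' Sx; rewrite leNgt ds lt.
exists B; split.
- move=> i A; rewrite /B; case: (unpickle i) => // -[n k] [p _ <-].
  apply/dop => y [x Sx xy].
  have /dop := metric_ball_open x (r k / 3) dm.
  by move=> /(_ y xy)[e e0 He]; exists e => // z /He /= xz; exists x.
- move=> i x; rewrite /B; case: (unpickle i) => [[n k]|]; last first.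
    exists setT; first by split=> //; apply/dop => y _; exists 1.
    by rewrite (_ : [set _ | _] = set0) // -subset0 => ? [].
  (* Two points of this ball are less than [r k / 3] apart, so by [Du] it meets at most one
     member. *)
  exists [set y | d x y < r k / 6].
    split; first exact: metric_ball_open dm.
    by rewrite /= (dE x x).2// divr_gt0.
  have [[A0 A0P]|/forallNP none] := pselect (exists A, range (E n k) A /\
      A `&` [set y | d x y < r k / 6] !=set0); last first.
    by rewrite (_ : [set _ | _] = set0) // -subset0 => A /none.
  apply: (@sub_finite_set _ _ [set A0]) => // A [[p _ <-] [y [Ey xy]]].
  move: A0P => [[q _ <-] [z [Ez xz]]].
  rewrite (Du n k p q y z) //.
  have := dt y x z; rewrite (ds y x); move: xy xz => /=; lra.
- move=> x U /dop xU Ux; have [e e0 eU] := xU x Ux.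
  have [n ne] : exists n, r n < e / 2 by apply: exists_invS_lt; rewrite divr_gt0.
  (* Leastness of [p] puts [x] into [S n k p] once [r k] is small; the piece stays in the [r n]-ball
     of [p], hence within [e] of [x]. *)
  have [|p px pmin] := le_min [set p | d p x < r n].
    by exists x => /=; rewrite (dE x x).2.
  have := metric_ball_open p (r n) dm => /dop /(_ _ px)[e' e'0 He'].
  have [k ke'] := exists_invS_lt e'0.
  exists (pickle (n, k)), (E n k p); split.
  + by rewrite /B pickleK; exists p.
  + exists x; last by rewrite (dE x x).2 // divr_gt0.
    by split=> [z xz|q npq /pmin //]; apply: He'; apply: lt_trans xz ke'.
  + move=> y [z [zp _] zy]; apply: eU.
    have rk : r k / 3 < r k by have := r0 k; lra.
    have := zp y (lt_trans zy rk).
    have := dt x p y; rewrite (ds x p); move: px => /=; lra.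
Qed.

Lemma metrizable_sigma_lf_weak_base (T : Type) (op : set (set T)) :
  metrizable op -> has_sigma_lf_weak_base op.
Proof.
move=> mop; have [B [Bop Blf Bb]] := metrizable_sigma_lf_base mop.
have [d [_ _ _ _ dop]] := mop.
have opI U V : op U -> op V -> op (U `&` V).
  move=> /dop oU /dop oV; apply/dop => x [/oU[e e0 eU] /oV[f f0 fV]].
  exists (Num.min e f); first by rewrite lt_min e0.
  by move=> y; rewrite lt_min => /andP[/eU ? /fV].
exists (fun y => [set V | (exists n, B n V) /\ V y]); split; last first.
  (* The empty set belongs to the family of no point, so it must be dropped from each layer. *)
  exists (fun n => [set V | B n V /\ V !=set0]); split.
    apply/seteqP; split=> [V [y [[n BV] Vy]]|V [n _ [BV [y Vy]]]].
      by exists n => //; split=> //; exists y.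
    by exists y; split=> //; exists n.
  move=> n x; have [U Ux fU] := Blf n x; exists U => //.
  by apply: sub_finite_set fU => V [[]].
split.
- move=> y U V [[n /Bop oU] Uy] [[m /Bop oV] Vy].
  have [k [W [BW Wy WUV]]] := Bb y (U `&` V) (opI _ _ oU oV) (conj Uy Vy).
  by exists W => //; split=> //; exists k.
- by move=> y U [].
- move=> y U oU Uy; have [n [V [BV Vy VU]]] := Bb y U oU Uy.
  by exists V => //; split=> //; exists n.
- move=> G GP; apply/dop => y /GP[V [[n /Bop/dop oV] /oV [e e0 eV]] VG].
  by exists e => // z /eV /VG.
Qed.

(** * The Nagata-Smirnov theorem *)

Lemma filter_bigcap_finite (T : Type) (I : choiceType) (D : set I)
    (f : I -> set T) (F : set_system T) : Filter F -> finite_set D ->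
  (forall i, D i -> F (f i)) -> F (\bigcap_(i in D) f i).
Proof.
move=> FF finD FD; rewrite -(fset_setK finD); apply: filter_bigI => i.
by rewrite in_fset_set // inE; exact: FD.
Qed.

Lemma locally_finite_sub (T : Type) (op F G : set (set T)) :
  F `<=` G -> locally_finite op G -> locally_finite op F.
Proof.
move=> FG lfG x; have [U Ux fU] := lfG x; exists U => //.
by apply: sub_finite_set fU => V [/FG].
Qed.

(** Only finitely many members meet some neighbourhood of [x], and the finite union of their
    closures is closed. *)
Lemma locally_finite_closure (X : topologicalType) (F : set (set X)) :
  locally_finite open F ->
  closure (\bigcup_(V in F) V) `<=` \bigcup_(V in F) closure V.
Proof.
move=> lfF x clx; have [U [oU Ux] finU] := lfF x.
apply: contrapT => nx.
have : closed (\bigcup_(V in [set V | F V /\ V `&` U !=set0]) closure V).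
  by apply: closed_bigcup => // V _; exact: closed_closure.
move=> /closed_openC oC.
have /clx [y [[V FV Vy] [Uy]]] : nbhs x (U `&` ~` (\bigcup_(V in
    [set V | F V /\ V `&` U !=set0]) closure V)).
  apply: filterI; first exact: open_nbhs_nbhs.
  apply: open_nbhs_nbhs; split=> // -[V [FV _] Vx]; apply: nx.
  by exists V.
apply; exists V; last exact: subset_closure.
by split=> //; exists y.
Qed.

Lemma regular_sigma_lf_base (X : topologicalType) (B : nat -> set (set X)) :
  regular_space X -> sigma_lf_base open B ->
  forall x U, open U -> U x -> exists n V, [/\ B n V, V x & closure V `<=` U].
Proof.
move=> reg [_ _ Bb] x U oU Ux.
have [N Nx NU] : filter_from (nbhs x) closure U.
  by apply: reg; exact: open_nbhs_nbhs.
have [|n [V [BV Vx VN]]] := Bb x N° (open_interior _); first exact: Nx.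
exists n, V; split=> //; apply: subset_trans NU; apply: closureS.
by apply: subset_trans VN _; exact: interior_subset.
Qed.

(** For a sigma-locally finite base of a regular space these sets exhaust an open [U] as [n] varies,
    while their closures stay inside [U]. *)
Definition shrink (X : topologicalType) (B : nat -> set (set X)) n (U : set X) :=
  \bigcup_(V in [set V | B n V /\ closure V `<=` U]) V.

Lemma closure_shrink (X : topologicalType) (B : nat -> set (set X)) n U :
  locally_finite open (B n) -> closure (shrink B n U) `<=` U.
Proof.
move=> lfB; have : locally_finite open [set V | B n V /\ closure V `<=` U].
  by apply: locally_finite_sub lfB => V [].
by move=> /locally_finite_closure H x /H[V [_]]; apply.
Qed.

Lemma shrink_open (X : topologicalType) (B : nat -> set (set X)) n U :
  B n `<=` open -> open (shrink B n U).
Proof. by move=> Bo; apply: bigcup_open => V [/Bo]. Qed.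

(** As for regular Lindelof spaces: each closed set has a countable open cover whose members have
    closures missing the other set, and each member is cut by the earlier closures from the opposite
    cover. *)
Lemma sigma_lf_base_normal (R : realType) (X : topologicalType)
    (B : nat -> set (set X)) :
  regular_space X -> sigma_lf_base open B -> normal_space X.
Proof.
move=> reg Bb; have [Bop Blf _] := Bb; apply/(@normal_openP R X) => C D cC cD CD0.
(* The bound [n.+1] removes the closure of index [n] too, which settles equal indices in the
   disjointness proof. *)
pose cut E F n := shrink B n (~` F) `\` \bigcup_(i in `I_n.+1) closure (shrink B i (~` E)).
have cut_open E F n : open (cut E F n).
  apply: openI; first exact/shrink_open/Bop.
  apply: closed_openC; apply: closed_bigcup; first exact: finite_II.
  by move=> i _; exact: closed_closure.
have cut_cover E F : closed F -> E `&` F = set0 -> E `<=` \bigcup_n cut E F n.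
  move=> cF EF0 x Ex.
  have [|n [V [BV Vx VF]]] := regular_sigma_lf_base reg Bb (closed_openC cF) (x := x).
    by move=> Fx; rewrite -[False]/(set0 x) -EF0.
  exists n => //; split; first by exists V.
  by move=> [i _ /closure_shrink]; apply=> //.
exists (\bigcup_n cut C D n), (\bigcup_n cut D C n); split.
- exact: bigcup_open.
- exact: bigcup_open.
- exact: cut_cover.
- by apply: cut_cover; rewrite // setIC.
- rewrite -subset0 => x [[n _ [Cx nDx]] [m _ [Dx nCx]]].
  have [nm|mn] := leqP n m.
    by apply: nCx; exists n => //=; exact: subset_closure.
  by apply: nDx; exists m => /=; [rewrite ltnW|exact: subset_closure].
Qed.

(** Normality gives, for layers [m], [n] and [V] in [B n], a Urysohn function equal to 1 on
    [shrink B m V] and to 0 off [V]; the metric is the supremum of the weighted differences. *)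
Lemma nagata_smirnov (R : realType) (X : topologicalType)
    (B : nat -> set (set X)) : regular_space X -> hausdorff_space X ->
  sigma_lf_base open B -> exists d : X -> X -> R, metrizes open d.
Proof.
move=> reg hau Bb; have [Bop Blf _] := Bb.
have nor := sigma_lf_base_normal R reg Bb.
pose Ix := (nat * nat * set X)%type.
pose J := [set t : Ix | B t.1.2 t.2].
have [f fP] : {f : Ix -> X -> R & forall t, J t -> [/\ continuous (f t),
    (forall x, 0 <= f t x <= 1), (forall x, ~ t.2 x -> f t x = 0) &
    (forall x, shrink B t.1.1 t.2 x -> f t x = 1)]}.
  apply: (@choice _ _ (fun (t : Ix) (f : X -> R) => J t -> [/\ continuous f,
    (forall x, 0 <= f x <= 1), (forall x, ~ t.2 x -> f x = 0) &
    (forall x, shrink B t.1.1 t.2 x -> f x = 1)])) => t.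
  have [Jt|nJt] := pselect (J t); last by exists (fun=> 0).
  have /(@uniform_separatorP _ R) : uniform_separator (~` t.2) (closure (shrink B t.1.1 t.2)).
    apply: ((@normal_separatorP R X).1 nor).
    - by apply: open_closedC; exact: Bop Jt.
    - exact: closed_closure.
    - by rewrite -subset0 => x [nx /(closure_shrink (Blf _))].
  move=> [g [cg g01 g0 g1]]; exists g => _; split=> //.
  - by move=> x; have /= := g01 (g x) (ex_intro2 _ _ x I erefl); rewrite in_itv.
  - by move=> x nx; apply: g0; exists x.
  - by move=> x Wx; apply: g1; exists x => //; exact: subset_closure.
(* The weight tends to 0 with the pair of layers, so that only finitely many layers
   matter in a given ball. *)
pose w (t : Ix) : R := (t.1.1 + t.1.2).+1%:R^-1.
have w0 t : 0 < w t by rewrite invr_gt0.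
have w1 t : w t <= 1 by rewrite invf_le1 // ler1n.
(* Including 0 keeps the supremum meaningful when [J] is empty. *)
pose S x y := [set r | r = 0 \/ exists2 t, J t & r = w t * `|f t x - f t y|].
pose d x y := sup (S x y).
have df t x y : J t -> `|f t x - f t y| <= 1.
  move=> /fP[_ f01 _ _]; rewrite ler_norml; have := f01 x; have := f01 y; lra.
have S_sup x y c : (forall t, J t -> w t * `|f t x - f t y| <= c) -> 0 <= c -> d x y <= c.
  move=> H c0; apply: ge_sup; first by exists 0; left.
  by move=> r [->|[t Jt ->]] //; exact: H.
have S_ub x y : has_ubound (S x y).
  exists 1 => r [->|[t Jt ->]] //.
  by rewrite -[leRHS]mulr1; apply: ler_pM; rewrite ?w1 ?df // ltW.
have le_d t x y : J t -> w t * `|f t x - f t y| <= d x y.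
  by move=> Jt; apply: ub_le_sup => //; right; exists t.
have d0 x y : 0 <= d x y by apply: ub_le_sup => //; left.
have sep x U : open U -> U x -> exists2 e, 0 < e & forall y, d x y < e -> U y.
  move=> oU Ux; have [_ _ /(_ x U oU Ux)[n [V [BV Vx VU]]]] := Bb.
  have [m [V' [BV' V'x V'V]]] := regular_sigma_lf_base reg Bb (Bop _ _ BV) Vx.
  have Jt : J (m, n, V) by [].
  exists (w (m, n, V)) => // y; rewrite ltNge => /negP dxy.
  apply: contrapT => nUy; apply: dxy; apply: le_trans (le_d _ x y Jt).
  have [_ _ f0 f1] := fP _ Jt.
  rewrite f1 ?f0; first by rewrite subr0 normr1 mulr1.
    by move=> /VU.
  by exists V'.
have dxx x : d x x = 0.
  apply/eqP; rewrite eq_le d0 andbT; apply: S_sup => // t _.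
  by rewrite subrr normr0 mulr0.
exists d; split=> //.
- move=> x y; split=> [dxy|-> //]; apply: hau => A C Ax Cy.
  have [e e0 H] := sep x A° (open_interior _) Ax.
  exists y; split; last exact: nbhs_singleton.
  by apply: interior_subset; apply: H; rewrite dxy.
- move=> x y; congr (sup _); apply/seteqP.
  by split=> r [->|[t Jt ->]]; [left|right; exists t|left|right; exists t];
     rewrite // distrC.
- move=> x y z; apply: S_sup; last by rewrite addr_ge0.
  move=> t Jt; apply: le_trans (lerD (le_d _ x y Jt) (le_d _ y z Jt)).
  by rewrite -mulrDr ler_wpM2l ?ler_distD // ltW.
move=> A; split=> [oA x Ax|H]; first exact: sep.
rewrite openE => x /H[e e0 He].
suff : nbhs x [set y | d x y < e] by apply: filterS => y; exact: He.
have e20 : 0 < e / 2 by rewrite divr_gt0.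
have [N Ne] : exists N, N.+1%:R^-1 < e / 2 :> R.
  by have [N] := ltr_add_invr e20; rewrite add0r; exists N.
(* Near [x] only finitely many [V] of a layer matter: for the others [f] vanishes at both points. *)
pose P (q : nat * nat) := [set y | forall V, B q.2 V -> `|f (q, V) x - f (q, V) y| < e / 2].
have Px q : nbhs x (P q).
  have [U [oU Ux] finU] := Blf q.2 x.
  suff : nbhs x (U `&` \bigcap_(V in [set V | B q.2 V /\ V `&` U !=set0])
      [set y | `|f (q, V) x - f (q, V) y| < e / 2]).
    apply: filterS => y [Uy Hy] V BV.
    have [VU|VU] := pselect (V `&` U !=set0); first exact: Hy.
    have nV z : U z -> ~ V z by move=> Uz Vz; apply: VU; exists z.
    have [_ _ f0 _] := fP (q, V) BV.
    by rewrite !f0 ?subrr ?normr0 //; exact: nV.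
  apply: filterI; first exact: open_nbhs_nbhs.
  apply: filter_bigcap_finite => // V [BV _].
  have [cf _ _ _] := fP (q, V) BV.
  exact: (@cvgrPdist_lt _ _ _ _ _ _ _).1 (cf x) _ e20.
have : nbhs x (\bigcap_(q in `I_N `*` `I_N) P q).
  by apply: filter_bigcap_finite => //; apply: finite_setX; exact: finite_II.
apply: filterS => y Hy.
suff : d x y <= e / 2 by rewrite /=; lra.
apply: S_sup; last exact: ltW.
move=> [q V] Jt; have [qN|qN] := pselect ((`I_N `*` `I_N) q).
  rewrite -[leRHS]mul1r; apply: ler_pM; rewrite ?w1 // ?ltW //.
  exact: Hy.
rewrite -[leRHS]mulr1; apply: ler_pM; rewrite ?df // ?ltW //.
apply: le_lt_trans Ne; rewrite /w lef_pV2 ?posrE // ler_nat /=.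
rewrite ltnS leqNgt; apply/negP => lt; apply: qN; split => /=.
  by apply: leq_ltn_trans lt; rewrite leq_addr.
by apply: leq_ltn_trans lt; rewrite leq_addl.
Qed.

(** * The Hausdorff metric *)

(* [compact_cover] is stated for pointed spaces only. *)
Lemma compact_cover_compact (X : topologicalType) (K : set X) :
  compact K -> K !=set0 -> cover_compact K.
Proof.
move=> cK [p Kp].
pose pX : ptopologicalType := HB.pack (X : Type) X (isPointed.Build X p).
have := @compact_cover pX; move=> /(congr1 (fun P => P K)) E.
by have : @cover_compact pX K by rewrite -E.
Qed.

Lemma hyperspace_eq (X : topologicalType) (K L : hyperspace X) :
  hval K = hval L -> K = L.
Proof.
case: K L => [K K0 cK] [L L0 cL] /= KL; case: _ / KL in L0 cL *.
by rewrite (Prop_irrelevance K0 L0) (Prop_irrelevance cK cL).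
Qed.

Lemma seq_lower_bound (I : eqType) (s : seq I) (g : I -> R) :
  (forall i, i \in s -> 0 < g i) ->
  exists2 e, 0 < e & forall i, i \in s -> e <= g i.
Proof.
elim: s => [|i s IH] gs; first by exists 1.
have [j js|e e0 es] := IH; first by apply: gs; rewrite inE js orbT.
exists (Num.min e (g i)).
  by rewrite lt_min e0 gs // inE eqxx.
move=> j; rewrite inE ge_min => /orP[/eqP ->|/es ->] //.
by rewrite lexx orbT.
Qed.

(** The bound makes 1 an admissible radius for any two compact sets, so the infimum in
    [hausdorff_metric] is over a nonempty set. *)
Lemma metrizable_bounded (T : Type) (op : set (set T)) : metrizable op ->
  exists2 d : T -> T -> R, metrizes op d & forall x y, d x y <= 1.
Proof.
case=> d [d0 dE ds dt dop].
exists (fun x y => Num.min (d x y) 1); last by move=> x y; rewrite ge_min lexx orbT.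
split.
- by move=> x y; rewrite le_min d0 ler01.
- move=> x y; rewrite -dE; split=> [|->]; last by rewrite min_l.
  by case: (leP (d x y) 1) => // _ /eqP; rewrite oner_eq0.
- by move=> x y; rewrite ds.
- move=> x y z; have := dt x y z; have := d0 x y; have := d0 y z.
  by case: (leP (d x y) 1); case: (leP (d y z) 1); case: (leP (d x z) 1); lra.
- move=> A; rewrite dop; split=> H x /H[e e0 He].
    exists (Num.min e 1); first by rewrite lt_min e0 ltr01.
    move=> y; case: (leP (d x y) 1) => _; rewrite lt_min ?ltxx ?andbF //.
    by move=> /andP[/He].
  by exists e => // y ye; apply: He; rewrite gt_min ye.
Qed.

(** Finitely many balls of half the radius allowed by [U] cover [K]; the least half-radius works. *)
Lemma lebesgue_number (X : topologicalType) (d : X -> X -> R) (K U : set X) :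
  metrizes (@open X) d -> compact K -> K !=set0 -> open U -> K `<=` U ->
  exists2 e, 0 < e & forall x y, K x -> d x y < e -> U y.
Proof.
move=> dm cK K0 oU KU; have [d0 dE ds dt dop] := dm.
have [g gP] : {g : X -> R & forall x, K x -> 0 < g x /\ forall y, d x y < g x -> U y}.
  apply: (@choice _ _ (fun x e => K x -> 0 < e /\ forall y, d x y < e -> U y)) => x.
  have [Kx|nKx] := pselect (K x); last by exists 0.
  by have [e e0 He] := (dop U).1 oU x (KU _ Kx); exists e.
have [|x Kx|D DK KD] := compact_cover_compact cK K0 (D := K)
    (f := fun x => [set y | d x y < g x / 2]).
- by move=> x _; exact: metric_ball_open.
- by exists x => //=; rewrite (dE x x).2 // divr_gt0 //; exact: (gP x Kx).1.
have [i iD|e e0 eD] := @seq_lower_bound _ (finmap.enum_fset D) (fun x => g x / 2).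
  by rewrite divr_gt0 //; apply: (gP _ _).1; apply: set_mem; exact: DK.
exists e => // x y /KD[p /= pD px] xy.
apply: (gP p _).2; first by apply: set_mem; exact: DK.
by have := eD p pD; have := dt p x y; lra.
Qed.

Lemma hausdorff_metric (X : topologicalType) : hausdorff_space X ->
  metrizable (@open X) -> metrizable (@vietoris_open X).
Proof.
move=> hau /metrizable_bounded[d dm d1]; have [d0 dE ds dt dop] := dm.
pose S (K L : hyperspace X) := [set e : R | [/\ 0 <= e,
  (forall x, hval K x -> exists2 y, hval L y & d x y <= e) &
  (forall x, hval L x -> exists2 y, hval K y & d x y <= e)]].
pose h K L := inf (S K L).
have S0 K L : S K L !=set0.
  exists 1; split=> // x _.
    by have [y Ly] := hval_nonempty L; exists y.
  by have [y Ky] := hval_nonempty K; exists y.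
have Slb K L : has_lbound (S K L) by exists 0 => e [].
have h_le K L e : S K L e -> h K L <= e by move=> ?; exact: ge_inf.
have h_lt K L e : h K L < e -> exists2 e', S K L e' & e' < e.
  by move=> ?; exact: inf_lt.
have h0 K L : 0 <= h K L by apply: lb_le_inf => // e [].
have hs K L : h K L = h L K.
  by congr inf; apply/seteqP; split=> e [? ? ?].
(* Distance 0 puts each point of [K] in the closure of [L], which is closed as a compact set in a
   Hausdorff space. *)
have h_sub K L : h K L = 0 -> hval K `<=` hval L.
  move=> hKL x Kx; have /closure_id -> := compact_closed hau (@hval_compact X L).
  move=> A /=.
  rewrite nbhsE => -[U [oU Ux] UA]; have [e e0 He] := (dop U).1 oU x Ux.
  have [|e' [_ /(_ x Kx)[y Ly xy] _] e'e] := h_lt K L e; first by rewrite hKL.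
  by exists y; split=> //; apply: UA; apply: He; exact: le_lt_trans e'e.
exists h; split=> //.
- move=> K L; split=> [hKL|->].
    by apply/hyperspace_eq/seteqP; split; apply: h_sub; rewrite // hs.
  apply/eqP; rewrite eq_le h0 andbT; apply: h_le; split=> // x Lx; exists x => //;
    by rewrite (dE x x).2.
- move=> K L M; rewrite leNgt; apply/negP => lt.
  (* A third of the defect: enlarging both distances by [e] still leaves a sum below [h K M]. *)
  pose e := (h K M - h K L - h L M) / 3.
  have e0 : 0 < e by rewrite /e; lra.
  have [|a [a0 aKL aLK] ae] := h_lt K L (h K L + e); first by rewrite ltrDl.
  have [|b [b0 bLM bML] be] := h_lt L M (h L M + e); first by rewrite ltrDl.
  suff /h_le : S K M (a + b) by rewrite /e in ae be; lra.
  split; first by rewrite addr_ge0.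
    move=> x /aKL[y /bLM[z Mz yz] xy]; exists z => //.
    by have := dt x y z; lra.
  move=> x /bML[y /aLK[z Mz yz] xy]; exists z => //.
  by have := dt x y z; lra.
move=> A; split=> [oA K /oA[Us [oUs [KUs KU] UsA]]|H K /H[e e0 He]].
  (* The Lebesgue number [e1] keeps [L] inside the union; [e2] makes [L] meet each [U] near a chosen
     point of [K]. *)
  have oUU : open (\bigcup_(U in [set U | U \in Us]) U) by apply: bigcup_open.
  have [e1 e10 He1] := lebesgue_number dm (@hval_compact X K) (hval_nonempty K) oUU KUs.
  have [g gP] : {g : set X -> R & forall U, U \in Us -> 0 < g U /\
      exists2 p, hval K p & forall y, d p y < g U -> U y}.
    apply: (@choice _ _ (fun U e => U \in Us -> 0 < e /\
      exists2 p, hval K p & forall y, d p y < e -> U y)) => U.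
    have [UUs|] := boolP (U \in Us); last by exists 0.
    have [p [Kp Up]] := KU U UUs.
    have [e e0 He] := (dop U).1 (oUs U UUs) p Up.
    by exists e; split=> //; exists p.
  have [|e2 e20 He2] := @seq_lower_bound _ Us g; first by move=> U /gP[].
  exists (Num.min e1 e2); first by rewrite lt_min e10.
  move=> L /h_lt[e [_ eKL eLK]]; rewrite lt_min => /andP[ee1 ee2].
  apply: UsA; split=> [y /eLK[x Kx yx]|U UUs].
    by apply: (He1 x) => //; rewrite ds; exact: le_lt_trans ee1.
  have [_ [p /eKL[y Ly py] pU]] := gP U UUs.
  exists y; split=> //; apply: pU; apply: le_lt_trans py _.
  exact: lt_le_trans ee2 (He2 _ UUs).
(* Points of one [e / 4]-ball are less than [e / 2] apart, so a finite cover of [K] by such balls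
   defines a basic set within [e / 2] of [K]. *)
have e40 : 0 < e / 4 by rewrite divr_gt0.
have [|x Kx|D DK KD] := compact_cover_compact (@hval_compact X K) (hval_nonempty K)
    (D := hval K) (f := fun x => [set y | d x y < e / 4]).
- by move=> x _; exact: metric_ball_open.
- by exists x => //=; rewrite (dE x x).2.
have {}DK p : p \in finmap.enum_fset D -> hval K p by move=> /DK/set_mem.
exists [seq [set y | d x y < e / 4] | x <- finmap.enum_fset D]; split.
- by move=> U /mapP[x _ ->]; exact: metric_ball_open.
- split=> [x /KD[p pD px]|U /mapP[p pD ->]].
    by exists [set y | d p y < e / 4] => //; apply/mapP; exists p.
  by exists p; split; [exact: DK|rewrite /= (dE p p).2].
- move=> L [LUs UsL]; apply: He; suff /h_le : S K L (e / 2) by lra.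
  split; first by rewrite ltW // divr_gt0.
    move=> x /KD[p pD px].
    have [|y [Ly py]] := UsL [set y | d p y < e / 4].
      by apply/mapP; exists p.
    by exists y => //; have := dt x p y; rewrite (ds x p); move: px py => /=; lra.
  move=> y /LUs[U /mapP[p pD ->] py]; exists p; first exact: DK.
  by rewrite ds; move: py => /=; lra.
Qed.

(** * Weak bases of the hyperspace *)

(** Stated for a bare family of open sets, since the Vietoris topology is given only as
    [vietoris_open]. *)
Definition seq_to (T : Type) (op : set (set T)) (a : nat -> T) (x : T) :=
  forall U, op U -> U x -> exists N, forall n, (N <= n)%N -> U (a n).

Definition hausdorff_op (T : Type) (op : set (set T)) := forall x y : T, x <> y ->
  exists U V, [/\ op U, op V, U x, V y & forall z, U z -> ~ V z].

Lemma weak_base_finite_refine (T : Type) (op : set (set T)) P (S : set (set T)) y :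
  is_weak_base op P -> op setT -> finite_set S -> S `<=` P y ->
  exists2 W, P y W & forall A, S A -> W `<=` A.
Proof.
move=> [PI _ Pop _] opT /finite_seqP[s ->] {S}.
elim: s => [_|A s IH sP].
  by have [W PW _] := Pop y _ opT I; exists W.
have [|W PW Ws] := IH; first by move=> B Bs; apply: sP; rewrite /= inE Bs orbT.
have [|W' PW' W'W] := PI y A W _ PW; first by apply: sP; rewrite /= inE eqxx.
exists W' => // B; rewrite /= inE => /orP[/eqP ->|/Ws WB] z /W'W[] // _.
exact: WB.
Qed.

(** All members of [P y] contain [y], so each layer has finitely many of them; [D n] refines those
    of the layers up to [n]. *)
Lemma weak_base_seq (T : Type) (op : set (set T)) P y :
  is_weak_base op P -> op setT ->
  sigma_locally_finite op [set A | exists y, P y A] ->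
  exists2 D : nat -> set T, forall n, P y (D n) &
    forall U, op U -> U y -> exists N, forall n, (N <= n)%N -> D n `<=` U.
Proof.
move=> wP opT [G [GE Glf]]; have [_ Py Pop _] := wP.
have /choice[D DP] : forall n, exists W, P y W /\
    forall i A, (i <= n)%N -> G i A -> P y A -> W `<=` A.
  move=> n; pose S := \bigcup_(i in `I_n.+1) [set A | G i A /\ P y A].
  have finS : finite_set S.
    apply: bigcup_finite; first exact: finite_II.
    move=> i _; have [U [_ Uy] finU] := Glf i y.
    apply: sub_finite_set finU => A [GA PA]; split=> //.
    by exists y; split=> //; exact: Py PA.
  have [|W PW WS] := weak_base_finite_refine wP opT finS (y := y).
    by move=> A [i _ []].
  exists W; split=> // i A iN GA PA; apply: WS; exists i => //=.
exists D => [n|U oU Uy]; first exact: (DP n).1.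
have [Q PQ QU] := Pop y U oU Uy.
have [i _ GQ] : (\bigcup_(n in setT) G n) Q by rewrite -GE; exists y.
by exists i => n iN; apply: subset_trans QU; exact: (DP n).2 iN GQ PQ.
Qed.

(** Deleting the terms outside [Q] leaves an open set [G]: at [x] this is witnessed by [Q],
    elsewhere by the Hausdorff property. The sequence ends up in [G], hence in [Q]. *)
Lemma weak_base_seq_nbhs (T : Type) (op : set (set T)) P (a : nat -> T) x Q :
  is_weak_base op P -> op setT -> hausdorff_op op -> seq_to op a x -> P x Q ->
  exists N, forall n, (N <= n)%N -> Q (a n).
Proof.
move=> [PI Py Pop Po] opT sep ax PQ; apply: contrapT => /forallNP nQ.
pose G := [set z | forall j, ~ Q (a j) -> a j <> z].
have oG : op G.
  apply: Po => z Gz; have [->|zx] := pselect (z = x).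
    by exists Q => // t Qt j nQj jt; apply: nQj; rewrite jt.
  have [U [V [oU oV Uz Vx UV]]] := sep z x zx.
  have [N VN] := ax V oV Vx.
  have [Q0 PQ0 Q0U] := Pop z U oU Uz.
  (* Deleted terms of index below [N] are avoided one by one; [U] avoids the tail. *)
  have [W PW WN] : exists2 W, P z W & forall j, (j < N)%N -> ~ Q (a j) -> ~ W (a j).
    elim: N {VN} => [|N [W PW WN]]; first by exists Q0.
    have [QN|nQN] := pselect (Q (a N)).
      exists W => // j; rewrite ltnS leq_eqVlt => /orP[/eqP -> //|]; exact: WN.
    have [U' [V' [oU' _ U'z V'a U'V']]] := sep z (a N) (nesym (Gz _ nQN)).
    have [Q1 PQ1 Q1U'] := Pop z U' oU' U'z.
    have [W' PW' W'W] := PI z W Q1 PW PQ1.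
    exists W' => // j; rewrite ltnS leq_eqVlt => /orP[/eqP -> _|jN nQj] /W'W[].
      by move=> _ /Q1U' /U'V'.
    by move=> /(WN j jN nQj).
  have [W' PW' W'W] := PI z W Q0 PW PQ0.
  exists W' => // t /W'W[Wt /Q0U Ut] j nQj jt; move: Wt Ut; rewrite -jt.
  have [jN|Nj] := ltnP j N; first by move=> /(WN j jN nQj).
  by move=> _ /UV; apply; exact: VN.
have [|N GN] := ax G oG; first by move=> j nQj jx; apply: nQj; rewrite jx; exact: Py PQ.
apply: (nQ N) => n /GN Gn; apply: contrapT => nQn; exact: (Gn n nQn).
Qed.

Lemma hausdorff_separated (X : topologicalType) :
  hausdorff_space X -> hausdorff_op (@open X).
Proof.
rewrite open_hausdorff => hau x y /eqP /hau[[U V] /= [/set_mem Ux /set_mem Vy]].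
move=> [oU oV /eqP UV]; exists U, V; split=> // z Uz Vz.
by rewrite -[False]/(set0 z) -UV.
Qed.

(** If [y] is not a cluster point, some member of [F] misses a neighbourhood of [y], which leaves
    only finitely many [x k]. *)
Lemma seq_to_compact (X : topologicalType) (x : nat -> X) y :
  seq_to (@open X) x y -> compact (y |` range x).
Proof.
move=> xy F FF FK; have [cy|] := pselect (cluster F y).
  by exists y => //; split=> //; left.
move=> /existsNP[A /existsNP[U /not_implyP[FA /not_implyP[Uy AU]]]].
have [N xN] := xy U° (open_interior _) Uy.
have fin : finite_set (x @` `I_N) by apply: finite_image; exact: finite_II.
have [|z [[k kN <-] cz]] := finite_compact fin (F := F).
  apply: filterS (filterI FA FK) => z [Az [zy|[k _ kz]]].
    by case: AU; exists z; split=> //; rewrite zy; exact: nbhs_singleton.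
  exists k => //=; rewrite ltnNge; apply/negP => /xN xk.
  by case: AU; exists z; split=> //; rewrite -kz; exact: interior_subset.
by exists (x k) => //; split=> //; right; exists k.
Qed.

(** * Singletons and open sets in the Vietoris topology *)

Definition hsing (X : topologicalType) (x : X) : hyperspace X :=
  Hyp (ex_intro (fun y => [set x] y) x erefl) (@compact_set1 X x).

Lemma hadd_proof (X : topologicalType) (K : hyperspace X) z :
  (hval K `|` [set z]) !=set0 /\ compact (hval K `|` [set z]).
Proof.
split; first by exists z; right.
by apply: compactU; [exact: (@hval_compact X K)|exact: compact_set1].
Qed.

Definition hadd (X : topologicalType) (K : hyperspace X) z : hyperspace X :=
  Hyp (hadd_proof K z).1 (hadd_proof K z).2.

Lemma vietoris_openT (X : topologicalType) : vietoris_open (@setT (hyperspace X)).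
Proof.
move=> K _; exists [:: setT]; split=> //.
  by move=> U; rewrite inE => /eqP ->; exact: openT.
split=> [x _|U]; first by exists setT => //=; rewrite inE.
by rewrite inE => /eqP ->; rewrite setIT; exact: hval_nonempty.
Qed.

Lemma vietoris_open_sub (X : topologicalType) (U : set X) :
  open U -> vietoris_open [set K | hval K `<=` U].
Proof.
move=> oU K KU; exists [:: U]; split.
- by move=> V; rewrite inE => /eqP ->.
- split=> [x /KU Ux|V]; first by exists U => //=; rewrite inE.
  rewrite inE => /eqP ->; have [x Kx] := hval_nonempty K.
  by exists x; split=> //; exact: KU.
- by move=> L [LU _] x /LU[V]; rewrite /= inE => /eqP ->.
Qed.

Lemma vietoris_open_meet (X : topologicalType) (U : set X) :
  open U -> vietoris_open [set K | hval K `&` U !=set0].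
Proof.
move=> oU K KU; exists [:: setT; U]; split.
- by move=> V; rewrite !inE => /orP[] /eqP -> //; exact: openT.
- split=> [x Kx|V]; first by exists setT => //=; rewrite inE eqxx.
  rewrite !inE => /orP[] /eqP -> //; rewrite setIT; exact: hval_nonempty.
- by move=> L [_]; apply; rewrite !inE eqxx orbT.
Qed.

Lemma hsing_continuous (X : topologicalType) (A : set (hyperspace X)) :
  vietoris_open A -> open [set x | A (hsing x)].
Proof.
move=> oA; rewrite openE => x /oA[Us [oUs [xUs xU] UsA]].
have : nbhs x (\bigcap_(U in [set U | U \in Us]) U).
  apply: filter_bigcap_finite; first exact: finite_seq.
  move=> U UUs; apply: open_nbhs_nbhs; split; first exact: oUs.
  by have [_ [/= -> ]] := xU U UUs.
(* Some [V] in [Us] contains [x], so the list is nonempty and its intersection lies in its union. *)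
have [V VUs _] := xUs x erefl.
apply: filterS => z zU; apply: UsA; split=> [t /= ->|U /zU Uz]; last by exists z.
by exists V => //; exact: zU.
Qed.

(** A point of one set outside the other has, by regularity, a neighbourhood whose closure misses
    the other: meeting its interior excludes avoiding its closure. *)
Lemma vietoris_separated (X : topologicalType) : regular_space X ->
  hausdorff_space X -> hausdorff_op (@vietoris_open X).
Proof.
move=> reg hau.
have sep (K L : hyperspace X) p : hval K p -> ~ hval L p -> exists U V,
    [/\ vietoris_open U, vietoris_open V, U K, V L & forall M, U M -> ~ V M].
  move=> Kp nLp; have cL := compact_closed hau (@hval_compact X L).
  have [N Np NL] : filter_from (nbhs p) closure (~` hval L).
    by apply: reg; apply: open_nbhs_nbhs; split=> //; exact: closed_openC.
  exists [set M | hval M `&` N° !=set0], [set M | hval M `<=` ~` closure N]; split.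
  - exact/vietoris_open_meet/open_interior.
  - exact/vietoris_open_sub/closed_openC/closed_closure.
  - by exists p.
  - by move=> x Lx /NL.
  - by move=> M [x [Mx /interior_subset Nx]] /(_ x Mx); apply; exact: subset_closure.
move=> K L KL.
have [KsL|/existsNP[p /not_implyP[Kp nLp]]] := pselect (hval K `<=` hval L); last exact: sep Kp nLp.
have [LsK|/existsNP[p /not_implyP[Lp nKp]]] := pselect (hval L `<=` hval K).
  by case: KL; apply/hyperspace_eq/seteqP.
have [U [V [oU oV UL VK UV]]] := sep _ _ _ Lp nKp.
by exists V, U; split=> // M VM UM; exact: UV UM VM.
Qed.

(** Two points of [K] have disjoint open neighbourhoods, and no singleton meets both. *)
Lemma vietoris_nonsingleton_open (X : topologicalType) :
  hausdorff_space X -> vietoris_open [set K : hyperspace X | forall z, K <> hsing z].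
Proof.
move=> /hausdorff_separated sep K Ks; have [p Kp] := hval_nonempty K.
have [q [Kq qp]] : exists q, hval K q /\ q <> p.
  apply: contrapT => /forallNP H; apply: (Ks p); apply/hyperspace_eq/seteqP.
  by split=> [q Kq|q /= -> //]; apply: contrapT => qp; apply: (H q).
have [U [V [oU oV Uq Vp UV]]] := sep q p qp.
exists [:: setT; U; V]; split.
- by move=> W; rewrite !inE => /or3P[] /eqP -> //; exact: openT.
- split=> [x Kx|W]; first by exists setT => //=; rewrite inE eqxx.
  by rewrite !inE => /or3P[] /eqP ->; [exists p|exists q|exists p].
- move=> L [_ LU] z Lz.
  have [|x []] := LU U; first by rewrite !inE eqxx orbT.
  have [|y []] := LU V; first by rewrite !inE eqxx !orbT.
  by rewrite Lz /= => -> Vz -> /UV.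
Qed.

(** Singletons form a closed copy of [X], and weak bases pass to closed subspaces. *)
Lemma weak_base_trace_open (X : topologicalType) P (G : set X) :
  hausdorff_space X -> is_weak_base (@vietoris_open X) P ->
  (forall y, G y -> exists2 Q, P (hsing y) Q & forall z, Q (hsing z) -> G z) ->
  open G.
Proof.
move=> hau [_ _ Pop Po] HG.
(* Non-singletons form an open set, so they may be thrown in. *)
pose A := [set K | forall z, K = hsing z -> G z].
have hI (x y : X) : hsing x = hsing y -> x = y.
  by move=> /(congr1 (fun K => hval K x)) /= E; rewrite -[x = y]E.
have /hsing_continuous : vietoris_open A.
  apply: Po => K AK; have [[z Kz]|nK] := pselect (exists z, K = hsing z).
    have [Q PQ QG] := HG z (AK z Kz); rewrite Kz; exists Q => // L QL w Lw.
    by apply: QG; rewrite -Lw.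
  have [|Q PQ Qs] := Pop K _ (vietoris_nonsingleton_open hau).
    by move=> z Kz; apply: nK; exists z.
  by exists Q => // L /Qs Ls z /Ls.
congr open; apply/seteqP; split=> x /=; first by apply.
by move=> Gx z /hI <-.
Qed.

(** Supplies the many sequences with the same limit [K] on which the diagonal argument runs. *)
Lemma hadd_seq_to (X : topologicalType) (K : hyperspace X) (a : nat -> X) x :
  hval K x -> seq_to (@open X) a x -> seq_to (@vietoris_open X) (fun j => hadd K (a j)) K.
Proof.
move=> Kx ax A oA /oA[Us [oUs [KUs KU] UsA]].
have oO : open (\bigcup_(U in [set U | U \in Us]) U) by apply: bigcup_open.
have [N aN] := ax _ oO (KUs x Kx).
exists N => j /aN aj; apply: UsA; split=> [z [/KUs //|/= -> //]|U /KU[p [Kp Up]]].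
by exists p; split=> //; left.
Qed.

(** * Traces of a weak base on the singletons *)

Section WeakBase.
Context (X : topologicalType) (P : hyperspace X -> set (set (hyperspace X))).
Context (reg : regular_space X) (hau : hausdorff_space X).
Context (wP : is_weak_base (@vietoris_open X) P).
Context (lfP : sigma_locally_finite (@vietoris_open X) [set A | exists y, P y A]).

Let vT := @vietoris_openT X.

(** Any choice of one point from each trace of [D n] converges to [x], which turns weak-base
    conditions into sequences. *)
Let sing_seq x : exists2 D : nat -> set (hyperspace X), forall n, P (hsing x) (D n) &
  forall c : nat -> X, (forall n, D n (hsing (c n))) -> seq_to (@open X) c x.
Proof.
have [D PD Dop] := weak_base_seq (hsing x) wP vT lfP.
exists D => // c Dc U /vietoris_open_sub oU Ux.
have [|N DN] := Dop _ oU; first by move=> _ /= ->.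
by exists N => n /DN /(_ _ (Dc n)); apply.
Qed.

(** By [sing_seq] and [sing_seq_nbhs] these are exactly the limits of sequences in [A]. *)
Let seq_limit (A : set X) := [set z | forall Q, P (hsing z) Q -> exists2 a, A a & Q (hsing a)].

Let sing_seq_nbhs (c : nat -> X) x Q : seq_to (@open X) c x -> P (hsing x) Q ->
  exists N, forall n, (N <= n)%N -> Q (hsing (c n)).
Proof.
move=> cx PQ.
apply: (weak_base_seq_nbhs (a := fun n => hsing (c n)) wP vT (vietoris_separated reg hau) _ PQ).
by move=> U /hsing_continuous oU Ux; exact: (cx _ oU Ux).
Qed.

(* With [x k] in [seq_limit A] tending to [y] and [K] the compact set of all [x k] and
   [y], the sets [K] plus a point of [A] near [x k] tend to [K] for each fixed [k]. A
   countable weak base at [K] then admits a diagonal choice [b k], and the neighbourhoods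
   [OV m] keep [b] away from every [x m], so that [b] tends to [y]. *)
Lemma seq_limit_closed (A : set X) y :
  (forall Q, P (hsing y) Q -> exists2 z, seq_limit A z & Q (hsing z)) -> seq_limit A y.
Proof.
move=> By; apply: contrapT => nBy.
have /existsNP[Q0 /not_implyP[PQ0 /forall2NP nQ0]] := nBy.
have [D PD Dto] := sing_seq y.
have /choice[x xP] : forall n, exists z, seq_limit A z /\ D n (hsing z).
  by move=> n; have [z Bz Dz] := By _ (PD n); exists z.
have xy : seq_to (@open X) x y by apply: Dto => n; exact: (xP n).2.
(* Here [x k] differs from [y], because it lies in [seq_limit A] and [y] does not. *)
have /choice[OV OVP] : forall k, exists UV : set X * set X,
    [/\ open UV.1, open UV.2, UV.1 (x k), UV.2 y & forall z, UV.1 z -> ~ UV.2 z].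
  move=> k; have [|U [V H]] := hausdorff_separated hau (x := x k) (y := y).
    by move=> xky; apply: nBy; rewrite -xky; exact: (xP k).1.
  by exists (U, V).
have K0 : (y |` range x) !=set0 by exists y; left.
pose K := Hyp K0 (seq_to_compact xy).
have [E PE Eop] := weak_base_seq K wP vT lfP.
have /choice[b bP] : forall k, exists b, [/\ A b, E k (hadd K b) &
    forall m, (m <= k)%N -> (OV m).2 (x k) -> (OV m).2 b].
  move=> k; have [C PC Cto] := sing_seq (x k).
  have /choice[a aP] : forall n, exists z, A z /\ C n (hsing z).
    by move=> n; have [z Bz Dz] := (xP k).1 _ (PC n); exists z.
  have ax : seq_to (@open X) a (x k) by apply: Cto => n; exact: (aP n).2.
  have Kxk : hval K (x k) by right; exists k.
  have [N aN] := weak_base_seq_nbhs wP vT (vietoris_separated reg hau)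
    (hadd_seq_to Kxk ax) (PE k).
  (* Restricting to those [m] whose [(OV m).2] contains [x k] makes [V] a neighbourhood of [x k]. *)
  pose V := \bigcap_(m in [set m | (m <= k)%N /\ (OV m).2 (x k)]) (OV m).2.
  have Vx : nbhs (x k) V.
    apply: filter_bigcap_finite => [|m [_ Vm]].
      by apply: (sub_finite_set _ (finite_II k.+1)) => m [].
    by apply: open_nbhs_nbhs; split=> //; have [] := OVP m.
  have [M aM] := ax V° (open_interior _) Vx.
  exists (a (maxn N M)); split; first exact: (aP _).1.
    by apply: aN; rewrite leq_maxl.
  by move=> m mk Vm; apply: (interior_subset (aM _ (leq_maxr N M))).
have [N bN] : exists N, forall n, (N <= n)%N -> Q0 (hsing (b n)).
  apply: sing_seq_nbhs PQ0 => U oU Uy.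
  have [N1 xU] := xy U oU Uy.
  have /choice[M MP] : forall m, exists M, forall k, (M <= k)%N -> (OV m).2 (x k).
    by move=> m; have [_ oV _ Vy _] := OVP m; exact: (xy _ oV Vy).
  (* This open set contains [K], hence eventually [b k]; for large [k] the sets [(OV m).2] keep
     [b k] out of the finitely many [(OV m).1], so it lies in [U]. *)
  have oO : open (U `|` \bigcup_(m in `I_N1) (OV m).1).
    by apply: openU => //; apply: bigcup_open => m _; have [] := OVP m.
  have [|N2 EN] := Eop _ (vietoris_open_sub oO).
    move=> z [->|[k _ <-]]; first by left.
    have [kN|Nk] := ltnP k N1; last by left; exact: xU.
    by right; exists k => //; have [] := OVP k.
  exists (maxn (maxn N1 N2) (\max_(m < N1) M m)) => k.
  rewrite !geq_max -andbA => /and3P[N1k N2k Mk].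
  have [Ab Eb bV] := bP k.
  have [] := EN k N2k _ Eb (b k); [by right|by []|move=> [m /= mN Om]].
  have [_ _ _ _ /(_ _ Om)[]] := OVP m.
  apply: bV; first by rewrite (leq_trans (ltnW mN)).
  apply: MP; apply: leq_trans Mk.
  exact: (@leq_bigmax _ (fun m : 'I_N1 => M m) (Ordinal mN)).
by have [Ab _ _] := bP N; have [] := nQ0 (b N); [|by apply; exact: bN].
Qed.

(** Let [A] be the complement of the trace. By [seq_limit_closed] the complement of [seq_limit A] is
    open; it contains [x] because of [Q], and it lies in the trace because [seq_limit A] contains
    [A]. *)
Lemma weak_base_trace_nbhs x Q : P (hsing x) Q -> nbhs x [set z | Q (hsing z)].
Proof.
move=> PQ; pose A := [set z | ~ Q (hsing z)].
have oB : open (~` seq_limit A).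
  apply: (weak_base_trace_open hau wP) => y nBy.
  apply: contrapT => /forall2NP H; apply/nBy/seq_limit_closed => Q' PQ'.
  by have [//|/existsNP[z /not_implyP[Qz /contrapT Bz]]] := H Q'; exists z.
have : nbhs x (~` seq_limit A).
  by apply: open_nbhs_nbhs; split=> // /(_ Q PQ)[a].
apply: filterS => z nBz; apply: contrapT => nQz; apply: nBz => Q' PQ'.
by exists z => //; have [_ Py _ _] := wP; exact: Py PQ'.
Qed.

(** Interiors of traces are open and, by [weak_base_trace_nbhs], keep the base point; local
    finiteness pulls back along [hsing]. *)
Lemma weak_base_trace_sigma_lf_base : exists B, sigma_lf_base (@open X) B.
Proof.
have [G [GE Glf]] := lfP; have [_ _ Pop _] := wP.
exists (fun n => [set [set z | Q (hsing z)]° | Q in G n]); split.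
- by move=> n _ [Q _ <-]; exact: open_interior.
- move=> n x; have [U [oU Ux] finU] := Glf n (hsing x).
  exists [set z | U (hsing z)]; first by split=> //; exact: hsing_continuous.
  apply: sub_finite_set (finite_image (fun Q => [set z | Q (hsing z)]°) finU).
  move=> _ [[Q GQ <-] [z [/interior_subset Qz Uz]]].
  by exists Q => //; split=> //; exists (hsing z).
- move=> x U oU Ux.
  have [|Q PQ QU] := Pop (hsing x) _ (vietoris_open_sub oU); first by move=> _ /= ->.
  have [n _ GQ] : (\bigcup_(n in setT) G n) Q by rewrite -GE; exists (hsing x).
  exists n, [set z | Q (hsing z)]°; split; first by exists Q.
    exact: weak_base_trace_nbhs.
  by move=> z /interior_subset /QU; apply.
Qed.

End WeakBase.

Theorem theorem3p13 (X : topologicalType) :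
  regular_space X -> hausdorff_space X ->
  (metrizable (@open X) <-> has_sigma_lf_weak_base (@vietoris_open X)) /\
  (metrizable (@open X) <-> metrizable (@vietoris_open X)).
Proof.
move=> reg hau.
have h13 := hausdorff_metric hau.
have h32 := @metrizable_sigma_lf_weak_base _ (@vietoris_open X).
have h21 : has_sigma_lf_weak_base (@vietoris_open X) -> metrizable (@open X).
  move=> [P [wP lfP]].
  have [B Bb] := weak_base_trace_sigma_lf_base reg hau wP lfP.
  exact: (nagata_smirnov _ reg hau Bb).
(* Metrizability returns from the hyperspace to [X] through [h32] and [h21]. *)
by split; split; auto.
Qed.
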